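(* Let $G$ be a free group, regarded as a discrete group. Then $G$ satisfies Ozawa's Property $O$: for every finite subset $E\subset G$ and every $\epsilon>0$ there exist a finite subset $F\subset G$ and a function $u\colon G\times G\to\mathbb{R}$ (an Ozawa kernel) such that (1) $u$ is a positive definite kernel; (2) for all $x,y\in G$, $u(x,y)\neq 0$ only if $x^{-1}y\in F$; (3) for all $x,y\in G$, $|1-u(x,y)|<\epsilon$ if $x^{-1}y\in E$.
   Context: A function $u\colon G\times G\to\mathbb{R}$ is a positive definite kernel if it is symmetric and $\sum_{i,j=1}^{k}\lambda_i\lambda_j u(x_i,x_j)\ge 0$ for all $k\in\mathbb{N}$, all $x_1,\dots,x_k\in G$ and all $\lambda_1,\dots,\lambda_k\in\mathbb{R}$. *)

(* Defs.v *)
From mathcomp Require Import all_boot all_order all_algebra.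
From mathcomp Require Import finmap.
From mathcomp Require Import boolp classical_sets reals.

Set Implicit Arguments.
Unset Strict Implicit.
Unset Printing Implicit Defensive.

Import Order.TTheory GRing.Theory Num.Theory.
Local Open Scope ring_scope.

(* Universal property of a free basis. [groupType] is MathComp's structure of
   arbitrary, possibly infinite, groups, and [UMagmaMorphism.type] its type of
   group homomorphisms. No cardinality bound is put on [X], so all ranks are
   allowed, including 0 and infinite ones. *)
Definition free_basis (G : groupType) (X : set G) : Prop :=
  forall (H : groupType) (f : X -> H),
    exists phi : UMagmaMorphism.type G H,
      (forall x : X, phi (\val x) = f x) /\
      (forall psi : UMagmaMorphism.type G H,
         (forall x : X, psi (\val x) = f x) -> psi =1 phi).

Definition free_group (G : groupType) : Prop :=
  exists X : set G, free_basis X.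

Definition positive_definite_kernel (R : realType) (T : Type)
    (u : T -> T -> R) : Prop :=
  (forall x y : T, u x y = u y x) /\
  (forall (k : nat) (x : 'I_k -> T) (lambda : 'I_k -> R),
     0 <= \sum_(i < k) \sum_(j < k) lambda i * lambda j * u (x i) (x j)).

Definition ozawa_kernel (R : realType) (G : groupType) (E F : {fset G})
    (eps : R) (u : G -> G -> R) : Prop :=
  [/\ positive_definite_kernel u,
      (forall x y : G, u x y != 0 -> (x^-1 * y)%g \in F) &
      (forall x y : G, (x^-1 * y)%g \in E -> `|1 - u x y| < eps)].

(* [G] is a discrete group, so its compact subsets are its finite ones and
   every kernel on it is continuous: no topology appears. *)
Definition property_O (R : realType) (G : groupType) : Prop :=
  forall (E : {fset G}) (eps : R), 0 < eps ->
    exists (F : {fset G}) (u : G -> G -> R), ozawa_kernel E F eps u.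

(* Main.v *)
Require Import Defs.
From HB Require Import structures.
From mathcomp Require Import all_boot all_order all_algebra.
From mathcomp Require Import finmap.
From mathcomp Require Import boolp classical_sets reals.
From mathcomp Require Import zify.

Set Implicit Arguments.
Unset Strict Implicit.
Unset Printing Implicit Defensive.

(* The Cayley graph of a free group with respect to a finite set S of basis
   elements is a forest. Send each x down the forest towards the shortest element
   of its component, and then along a ray attached there; let u(x, y) be 1/n
   times the number of common vertices of the first n steps from x and from y.
   This is a Gram kernel; u(x, y) <> 0 forces x^-1 y to be a product of fewer
   than 2n letters from S; and if x^-1 y is a word of length at most d in S then
   the two paths merge within d steps, so that 1 - d/n <= u(x, y) <= 1. Reduced
   words come from the right action of G on them, given by universality. *)

Import Order.TTheory GRing.Theory Num.Theory.

(** * Orbit-counting kernels *)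

Section OrbitCount.
Variables (T : eqType) (f : T -> T).
Local Open Scope nat_scope.

Definition orbit_count (n : nat) (s t : T) : nat :=
  \sum_(i < n) \sum_(j < n) (iter i f s == iter j f t).

Lemma orbit_countC n s t : orbit_count n s t = orbit_count n t s.
Proof.
rewrite /orbit_count exchange_big; apply: eq_bigr => i _.
by apply: eq_bigr => j _; rewrite eq_sym.
Qed.

Lemma orbit_count_le n s t :
  injective (fun j => iter j f t) -> orbit_count n s t <= n.
Proof.
move=> inj; rewrite -[leqRHS]card_ord -sum1_card; apply: leq_sum => i _.
have [j /eqP Ej|none] := pickP (fun j : 'I_n => iter i f s == iter j f t).
  rewrite (bigD1 j)//= Ej eqxx big1 // => k kj.
  by case: eqP => // jk; rewrite (ord_inj (inj _ _ jk)) eqxx in kj.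
by rewrite big1 // => j _; rewrite none.
Qed.

(** Once two orbits meet they agree up to the shift [a - b], so every [i >= d] is matched by
    [j = i - (a - b)]. *)
Lemma orbit_count_ge n d s t a b :
  a <= d -> b <= d -> iter a f s = iter b f t -> n - d <= orbit_count n s t.
Proof.
wlog ba : s t a b / b <= a => [hwlog|] ad bd st.
  have [ba|/ltnW ab] := leqP b a; first exact: hwlog ba ad bd st.
  by rewrite orbit_countC; apply: hwlog ab bd ad (esym st).
have -> : n - d = \sum_(i < n) (d <= i).
  rewrite -(big_mkord predT (fun i => nat_of_bool (d <= i))) /=.
  elim: n => [|n IH]; first by rewrite big_geq.
  by rewrite big_nat_recr //= -IH; have [|] := leqP d n; lia.
apply: leq_sum => i _; have [di|//] := leqP d i.
have jn : i - (a - b) < n by have := ltn_ord i; lia.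
rewrite (bigD1 (Ordinal jn)) //=.
suff -> : iter i f s = iter (i - (a - b)) f t by rewrite eqxx.
rewrite (_ : nat_of_ord i = (i - a) + a); last lia.
by rewrite iterD st -iterD; congr iter; lia.
Qed.

End OrbitCount.

(** * Positive definiteness and closeness to 1 *)

Section KernelTheory.
Variable R : realType.
Local Open Scope ring_scope.

(** Gram kernel of indicator functions: the form is the sum, over the values [z] of [v], of the
    squared total weight of the fibre above [z]. *)
Lemma quadratic_eq_ge0 (T : eqType) (P : finType) (v : P -> T) (mu : P -> R) :
  0 <= \sum_p \sum_q mu p * mu q * (v p == v q)%:R.
Proof.
pose V := undup [seq v p | p <- enum P].
have vV p : v p \in V by rewrite mem_undup map_f ?mem_enum.
have -> : \sum_p \sum_q mu p * mu q * (v p == v q)%:R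
    = \sum_(z <- V) (\sum_p mu p * (v p == z)%:R) ^+ 2.
  under [RHS]eq_bigr do rewrite expr2 big_distrlr /=.
  rewrite [RHS]exchange_big; apply: eq_bigr => p _ /=.
  rewrite [RHS]exchange_big; apply: eq_bigr => q _ /=.
  rewrite (bigD1_seq (v p)) ?undup_uniq//= eqxx big1 => [|z zp].
    by rewrite addr0 [v q == _]eq_sym mulr1 mulrA.
  by rewrite [v p == z]eq_sym (negbTE zp) mulr0 mul0r.
by apply: sumr_ge0 => z _; exact: sqr_ge0.
Qed.

Lemma orbit_count_pd (T : eqType) (U : Type) (f : T -> T) (r : U -> T) n :
  positive_definite_kernel
    (fun x y => (orbit_count f n (r x) (r y))%:R / n%:R : R).
Proof.
split=> [x y|k x lambda]; first by rewrite orbit_countC.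
(* Expanding the counts gives a form indexed by pairs (point, time), whose weights ignore the
   time. *)
have -> : \sum_i \sum_j lambda i * lambda j *
      ((orbit_count f n (r (x i)) (r (x j)))%:R / n%:R)
    = n%:R^-1 * \sum_(p : 'I_k * 'I_n) \sum_(q : 'I_k * 'I_n)
       lambda p.1 * lambda q.1 *
       (iter p.2 f (r (x p.1)) == iter q.2 f (r (x q.1)))%:R.
  rewrite -(pair_bigA _ (fun (i : 'I_k) (a : 'I_n) => \sum_(q : 'I_k * 'I_n)
    lambda i * lambda q.1 *
    (iter a f (r (x i)) == iter q.2 f (r (x q.1)))%:R)) /= mulr_sumr.
  apply: eq_bigr => i _.
  under [X in _ = _ * X]eq_bigr => a _ do
    rewrite -(pair_bigA _ (fun (j : 'I_k) (b : 'I_n) => lambda i * lambda j *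
      (iter a f (r (x i)) == iter b f (r (x j)))%:R)) /=.
  rewrite exchange_big mulr_sumr; apply: eq_bigr => j _ /=.
  rewrite /orbit_count natr_sum mulrA mulrC; congr (_ * _).
  rewrite mulr_sumr; apply: eq_bigr => a _.
  by rewrite natr_sum mulr_sumr.
by rewrite mulr_ge0 ?invr_ge0 ?ler0n // (@quadratic_eq_ge0 T _
  (fun p : 'I_k * 'I_n => iter p.2 f (r (x p.1)))).
Qed.

Lemma orbit_count_close (T : eqType) (f : T -> T) n d s t a b :
    (0 < n)%N -> injective (fun j => iter j f t) ->
    (a <= d)%N -> (b <= d)%N -> iter a f s = iter b f t ->
  `|1 - (orbit_count f n s t)%:R / n%:R| <= d%:R / n%:R :> R.
Proof.
move=> n0 inj ad bd st.
have le := orbit_count_le n s inj; have ge := orbit_count_ge n ad bd st.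
have nR : 0 < n%:R :> R by rewrite ltr0n.
rewrite ger0_norm; last first.
  by rewrite subr_ge0 ler_pdivrMr // mul1r ler_nat.
rewrite lerBlDl -mulrDl ler_pdivlMr // mul1r -natrD ler_nat; lia.
Qed.

End KernelTheory.

(** * Groups of permutations of a type *)

Record bijection (W : Type) := Bijection {
  bij_fun :> W -> W;
  bij_inv : W -> W;
  bij_funK : cancel bij_fun bij_inv;
  bij_invK : cancel bij_inv bij_fun }.

HB.instance Definition _ W := gen_eqMixin (bijection W).
HB.instance Definition _ W := gen_choiceMixin (bijection W).

Section BijectionGroup.
Variable W : Type.
Implicit Types a b c : bijection W.

Lemma bijectionP a b : a =1 b -> a = b.
Proof.
case: a b => [f f' fK f'K] [g g' gK g'K] /= /funext fg; subst g.
have : f' = g' by apply: funext => w; rewrite -[w in LHS]g'K fK.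
by move=> fg'; subst g'; congr Bijection; exact: Prop_irrelevance.
Qed.

Definition bij_one : bijection W := @Bijection W id id (frefl _) (frefl _).
Definition bij_invg a : bijection W := Bijection (bij_invK a) (bij_funK a).
(* Diagrammatic order, so that homomorphisms into this group are right actions. *)
Definition bij_mul a b : bijection W :=
  Bijection (can_comp (bij_funK b) (bij_funK a))
            (can_comp (bij_invK a) (bij_invK b)).

Lemma bij_mulA : associative bij_mul. Proof. by move=> a b c; exact: bijectionP. Qed.
Lemma bij_mul1 : left_id bij_one bij_mul. Proof. by move=> a; exact: bijectionP. Qed.
Lemma bij_mulr1 : right_id bij_one bij_mul. Proof. by move=> a; exact: bijectionP. Qed.
Lemma bij_mulV : left_inverse bij_one bij_invg bij_mul.
Proof. by move=> a; apply: bijectionP => w /=; rewrite bij_invK. Qed.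
Lemma bij_mulrV : right_inverse bij_one bij_invg bij_mul.
Proof. by move=> a; apply: bijectionP => w /=; rewrite bij_funK. Qed.

HB.instance Definition _ := isGroup.Build (bijection W)
  bij_mulA bij_mul1 bij_mulr1 bij_mulV bij_mulrV.

End BijectionGroup.

(** * Words *)

Section Words.
Variable G : groupType.
Local Open Scope group_scope.

(* [(x, true)] stands for x and [(x, false)] for x^-1. *)
Definition letter_val (l : G * bool) : G := if l.2 then l.1 else l.1^-1.
Definition letter_inv (l : G * bool) : G * bool := (l.1, ~~ l.2).
Definition word_val (ls : seq (G * bool)) : G :=
  foldr (fun l g => letter_val l * g) 1 ls.

Lemma letter_invK : involutive letter_inv.
Proof. by case=> x b; rewrite /letter_inv /= negbK. Qed.

Lemma letter_val_inv l : letter_val (letter_inv l) = (letter_val l)^-1.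
Proof. by case: l => x [] //; rewrite /letter_val /= invgK. Qed.

Lemma word_val_cat s t : word_val (s ++ t) = word_val s * word_val t.
Proof. by elim: s => [|l s IH] /=; rewrite ?mul1g // IH mulgA. Qed.

Lemma word_val_inv s : word_val (rev (map letter_inv s)) = (word_val s)^-1.
Proof.
elim: s => [|l s IH] /=; first by rewrite invg1.
by rewrite rev_cons -cats1 word_val_cat IH /= mulg1 letter_val_inv invgM.
Qed.

(* The last letter of the word comes first in the list. *)
Definition push (l : G * bool) (w : seq (G * bool)) : seq (G * bool) :=
  if w is m :: w' then if m == letter_inv l then w' else l :: w else [:: l].

Fixpoint reduced (w : seq (G * bool)) : bool :=
  if w is l :: w' then (ohead w' != Some (letter_inv l)) && reduced w'
  else true.

Lemma push_reduced l w : reduced w -> reduced (push l w).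
Proof.
case: w => [//|m w] /= /andP[mw rw]; case: ifPn => //= ml.
by rewrite mw rw !andbT.
Qed.

(** If [push l] deletes a head equal to the inverse of [l], reducedness keeps [l] from coming next,
    so the second push restores the head instead of cancelling again. *)
Lemma pushK l w : reduced w -> push (letter_inv l) (push l w) = w.
Proof.
case: w => [_|m w] /=; first by rewrite letter_invK eqxx.
case: (m =P letter_inv l) => [->|_] /andP[mw _] /=; last by rewrite letter_invK eqxx.
by case: w mw => //= k w; case: (k =P _) => // ->; rewrite eqxx.
Qed.

Definition reduced_word := {w : seq (G * bool) | reduced w}.

Definition push_rw (l : G * bool) (w : reduced_word) : reduced_word :=
  exist _ (push l (val w)) (push_reduced l (valP w)).

Lemma push_rwK l : cancel (push_rw l) (push_rw (letter_inv l)).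
Proof. by move=> w; apply: val_inj; rewrite /= pushK ?(valP w). Qed.

Lemma push_rwVK l : cancel (push_rw (letter_inv l)) (push_rw l).
Proof. by move=> w; rewrite -{1}[l]letter_invK push_rwK. Qed.

Definition push_bij (l : G * bool) : bijection reduced_word :=
  Bijection (push_rwK l) (push_rwVK l).

End Words.

(** * Generation and normal forms in a free group *)

Section FreeGroup.
Variables (G : groupType) (X : set G).
Local Open Scope group_scope.

Definition spanned : pred G := fun g =>
  `[< exists2 ls, {in ls, forall l : G * bool, l.1 \in X} & g = word_val ls >].

Lemma spanned_closed : group_closed spanned.
Proof.
split; first by apply/asboolP; exists [::].
move=> _ _ /asboolP[s sX ->] /asboolP[t tX ->]; apply/asboolP.
exists (s ++ rev (map (@letter_inv G) t)); last first.
  by rewrite word_val_cat word_val_inv.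
move=> l; rewrite mem_cat mem_rev => /orP[/sX //|/mapP[m /tX mX ->]].
exact: mX.
Qed.

Definition span := {g : G | spanned g}.
HB.instance Definition _ := SubChoice.on span.
HB.instance Definition _ :=
  SubChoice_isSubGroup.Build G spanned span spanned_closed.


Hypothesis hX : free_basis X.

(** Universality with target the subgroup [span] gives [phi : G -> span]. Followed by the inclusion,
    it agrees with the identity on [X], hence everywhere by uniqueness. *)
Lemma free_basis_spanned g : spanned g.
Proof.
have spanX (x : X) : spanned (val x).
  apply/asboolP; exists [:: (val x, true)] => [l|]; last by rewrite /= mulg1.
  by rewrite mem_seq1 => /eqP->; exact: (valP x).
have [phi [phiX _]] := hX (fun x : X => exist _ (val x) (spanX x) : span).
have [theta [_ theta_uniq]] := hX (fun x : X => val x).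
have -> : g = (val \o phi : UMagmaMorphism.type G G) g.
  rewrite (theta_uniq (val \o phi : UMagmaMorphism.type G G)) => [|x /=].
    exact: (theta_uniq (idfun : UMagmaMorphism.type G G)).
  by rewrite phiX.
exact: valP (phi g).
Qed.

(** Let each [x] in [X] act on reduced words by pushing [x]; [nf g] is the image of the empty word
    under [g]. *)
Lemma free_basis_words : exists nf : G -> seq (G * bool),
  forall g l, l.1 \in X -> nf (g * letter_val l) = push l (nf g).
Proof.
have [phi [phiX _]] := hX (fun x : X => push_bij (val x, true)).
exists (fun g => val (phi g (exist _ [::] isT))) => g [x b] /= xX.
have {}phiX : phi x = push_bij (x, true).
  exact: (phiX (exist _ x xX)).
by case: b; rewrite /letter_val /= gmulfM ?gmulfV phiX.
Qed.

End FreeGroup.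

(** * The forest spanned by finitely many generators *)

Section Forest.
Variables (G : groupType) (nf : G -> seq (G * bool)) (S : seq G).
Local Open Scope group_scope.
Hypothesis nf_push :
  forall g l, l.1 \in S -> nf (g * letter_val l) = push l (nf g).

(* Elements of G are the vertices [(g, 0)]; [(g, 1), (g, 2), ...] is the ray
   attached to a root g. *)
Definition step (t : G * nat) : G * nat :=
  match t.2, nf t.1 with
  | 0, l :: _ => if l.1 \in S then (t.1 * letter_val (letter_inv l), 0%N)
                 else (t.1, 1%N)
  | _, _ => (t.1, t.2.+1)
  end.

(** The height [t.2 - size (nf t.1)] grows by one at each step, written here without subtraction.
    The ray lets it keep growing past a root, so no orbit revisits a vertex. *)
Lemma step_height t :
  ((step t).2 + size (nf t.1) = (t.2 + size (nf (step t).1)).+1)%N.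
Proof.
rewrite /step; case: t => g [|k] /=; last by rewrite addSn.
case E: (nf g) => [|l w] /=; first by rewrite E.
case: ifP => lS /=; last by rewrite E.
by rewrite nf_push // E /= letter_invK eqxx.
Qed.

Lemma iter_step_height i t :
  ((iter i step t).2 + size (nf t.1) = t.2 + size (nf (iter i step t).1) + i)%N.
Proof.
elim: i => [|i IH]; first by rewrite addn0.
by have := step_height (iter i step t); rewrite iterS; lia.
Qed.

Lemma iter_step_inj t : injective (fun i => iter i step t).
Proof.
move=> i j /= ij.
by have := iter_step_height i t; have := iter_step_height j t; rewrite ij; lia.
Qed.

(** A letter either lengthens [nf g] or deletes its head; the endpoint with the longer word steps to
    the other. *)
Lemma step_adjacent g l : l.1 \in S ->
  step (g * letter_val l, 0%N) = (g, 0%N) \/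
  step (g, 0%N) = (g * letter_val l, 0%N).
Proof.
move=> lS; have := nf_push g lS; rewrite /step /=.
case E: (nf g) => [|m w] /=; last case: ifPn => [/eqP-> _|_].
- by move=> ->; rewrite lS letter_val_inv mulgK; left.
- by rewrite lS letter_invK; right.
- by move=> ->; rewrite lS letter_val_inv mulgK; left.
Qed.

(** Crossing one edge delays the meeting by one step on one of the two sides only. *)
Lemma step_merge g ls : {in ls, forall l : G * bool, l.1 \in S} ->
  exists a b, [/\ (a <= size ls)%N, (b <= size ls)%N &
    iter a step (g, 0%N) = iter b step (g * word_val ls, 0%N)].
Proof.
elim: ls g => [|l ls IH] g lsS; first by exists 0%N, 0%N; rewrite mulg1.
have [m mS|a [b [al bl E]]] := IH (g * letter_val l).
  by apply: lsS; rewrite in_cons mS orbT.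
rewrite /= mulgA; have [lg|gl] := step_adjacent g (lsS l (mem_head _ _)).
  exists a, b.+1; split; rewrite // ?ltnS //; first exact: leqW.
  by rewrite iterS -E -iterS iterSr lg.
exists a.+1, b; split; rewrite // ?ltnS //; first exact: leqW.
by rewrite iterSr gl.
Qed.

(** Each step multiplies the group component on the right by 1 or a letter over [S], so the possible
    displacements form a finite set independent of [t]. *)
Lemma step_reach n : exists L : seq G, forall k t, (k < n)%N ->
  t.1^-1 * (iter k step t).1 \in L.
Proof.
elim: n => [|n [L HL]]; first by exists [::].
pose A := 1 :: [seq letter_val (x, b) | x <- S, b <- [:: true; false]].
exists (1 :: [seq s * r | s <- A, r <- L]) => -[|k] t kn.
  by rewrite /= mulVg mem_head.
rewrite in_cons; apply/orP; right; apply/allpairsP.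
exists (t.1^-1 * (step t).1, (step t).1^-1 * (iter k step (step t)).1).
rewrite /= HL // -iterSr mulgA mulgK; split=> //.
rewrite /step; case: t {kn} => g [|k'] /=; last by rewrite mulVg mem_head.
case: (nf g) => [|[x b] w] /=; first by rewrite mulVg mem_head.
case: ifP => xS /=; last by rewrite mulVg mem_head.
rewrite mulKg in_cons; apply/orP; right; apply/allpairsP.
by exists (x, ~~ b); split=> //; case: b.
Qed.

End Forest.

(** * Choice of the finite generating data and the Ozawa kernel *)

Lemma finite_spanned (G : groupType) (X : set G) (E : seq G) :
    {in E, forall g, spanned X g} ->
  exists (S : seq G) (d : nat), {in S, forall x, x \in X} /\
    {in E, forall g, exists ls, [/\ {in ls, forall l : G * bool, l.1 \in S},
      (size ls <= d)%N & g = word_val ls]}.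
Proof.
elim: E => [|g E IH] EX; first by exists [::], 0%N.
have [h hE|S [d [SX HS]]] := IH; first by apply: EX; rewrite in_cons hE orbT.
have /asboolP[ls lsX gE] := EX g (mem_head _ _).
exists ([seq l.1 | l <- ls] ++ S), (maxn (size ls) d); split=> [x|h].
  by rewrite mem_cat => /orP[/mapP[l /lsX lX ->]|/SX].
rewrite in_cons => /orP[/eqP->|/HS[t [tS td hE]]].
  exists ls; split=> // [l lls|]; last exact: leq_maxl.
  by rewrite mem_cat map_f.
exists t; split=> // [l /tS lS|]; first by rewrite mem_cat lS orbT.
by rewrite leq_max td orbT.
Qed.

Theorem theorem1 (R : realType) (G : groupType) (hG : free_group G) :
  property_O R G.
Proof.
case: hG => X hX E eps eps0.
have [S [d [SX HS]]] := @finite_spanned G X E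
  (fun g _ => free_basis_spanned hX g).
have [nf nfX] := free_basis_words hX.
have nfS g l (lS : l.1 \in S) := nfX g l (SX _ lS).
have [n [n0 dn]] : exists n, (0 < n)%N /\ (d%:R / n%:R < eps :> R)%R.
  (* The successor makes [n] positive and strictly larger than [d / eps]. *)
  exists (Num.truncn (d%:R / eps)).+1; split=> //.
  by rewrite ltr_pdivrMr ?ltr0n // mulrC -ltr_pdivrMr // truncnS_gt.
have [L HL] := step_reach nf S n.
(* If the paths from [x] and [y] share a vertex over [z], then [r = x^-1 * z] and [q = y^-1 * z] lie
   in [L], and [x^-1 * y = r * q^-1]. *)
exists [fset z in [seq (r * q^-1)%g | r <- L, q <- L]]%fset.
exists (fun x y => (orbit_count (step nf S) n (x, 0%N) (y, 0%N))%:R / n%:R)%R.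
split.
- exact: (@orbit_count_pd R _ _ (step nf S) (fun x => (x, 0%N))).
- move=> x y; rewrite mulf_eq0 negb_or pnatr_eq0 => /andP[nz _].
  rewrite !inE; apply/allpairsP.
  have [i [j ij]] : exists i j : 'I_n,
      iter i (step nf S) (x, 0%N) = iter j (step nf S) (y, 0%N).
    apply: contrapT => none; case/eqP: nz; rewrite /orbit_count.
    rewrite big1 // => i _; rewrite big1 // => j _.
    by case: eqP => // ij; case: none; exists i, j.
  exists (x^-1 * (iter i (step nf S) (x, 0%N)).1,
          y^-1 * (iter j (step nf S) (y, 0%N)).1)%g.
  split; [exact: (HL i (x, 0%N))|exact: (HL j (y, 0%N))|].
  by rewrite /= ij invgM invgK mulgA mulgK.
- move=> x y /HS[ls [lsS lsd xy]]; apply: le_lt_trans dn.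
  (* The word for [x^-1 * y] leads from [x] to [y] in the forest. *)
  have [a [b [al bl]]] := step_merge nfS x lsS.
  rewrite -xy mulVKg => ab.
  apply: orbit_count_close ab; rewrite ?(leq_trans al) ?(leq_trans bl) //.
  exact: iter_step_inj nfS _.
Qed.
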